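(* Let $G$ be a finite nilpotent group of class at most $3$ with $\exp G=n$, and let $q\ge 0$ be an integer. Then: (i) $\exp(G\otimes^q G)$ divides $\exp G$ if $n$ is odd or $4\mid q$; (ii) $\exp(G\otimes^q G)$ divides $2\exp G$ otherwise.
   Context: Conventions: $x^y=y^{-1}xy$, $[x,y]=x^{-1}y^{-1}xy$. For a group $G$ and an integer $q\ge 1$, the $q$-tensor square $G\otimes^q G$ is the group generated by the symbols $g\otimes h$ and $\widehat k$, for $g,h,k\in G$, subject to the relations, for all $g,g_1,h,h_1,k,k_1\in G$: (1) $g\otimes hh_1=(g\otimes h_1)(g^{h_1}\otimes h^{h_1})$; (2) $gg_1\otimes h=(g^{g_1}\otimes h^{g_1})(g_1\otimes h)$; (3) $(g\otimes h)^{\widehat k}=g^{(k^q)}\otimes h^{(k^q)}$; (4) $\widehat{kk_1}=\widehat k\,\prod_{i=1}^{q-1}\bigl(k\otimes(k_1^{-i})^{k^{q-1-i}}\bigr)\,\widehat{k_1}$; (5) $[\widehat k,\widehat{k_1}]=k^q\otimes k_1^q$; (6) $\widehat{[g,h]}=(g\otimes h)^q$. For $q=0$, $G\otimes^0 G$ is the non-abelian tensor square $G\otimes G$: the group generated by the symbols $g\otimes h$ ($g,h\in G$) subject to relations (1) and (2) only. Note that $4\mid 0$. *)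

(* Defs.v *)
From HB Require Import structures.
From mathcomp Require Import all_boot all_fingroup all_solvable.
From mathcomp Require Import boolp.

Set Implicit Arguments.
Unset Strict Implicit.
Unset Printing Implicit Defensive.

Import GroupScope.
Local Open Scope group_scope.
Local Open Scope quotient_scope.

(* fingroup also exports a repr. *)
Local Notation repr := generic_quotient.repr.

(* Group words over X: (b, x) stands for x^-1 if b = true and for x if        *)
(* b = false. Words are not reduced; they form a monoid with a formal         *)
(* inversion, so that the notations x * y, x^-1, x ^+ n, x ^ y, [~ x, y] and  *)
(* \prod can be used to write relators.                                       *)
Definition gword (X : Type) := seq (bool * X).

Section GroupWords.
Variable X : choiceType.
Implicit Types u v w : gword X.

HB.instance Definition _ := Choice.on (gword X).

Definition gword_inv w : gword X := rev [seq (~~ bx.1, bx.2) | bx <- w].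

Fact gword_invK : involutive gword_inv.
Proof.
move=> w; rewrite /gword_inv map_rev revK -map_comp.
by rewrite -[RHS]map_id; apply: eq_map => -[b x] /=; rewrite negbK.
Qed.

Fact gword_invM :
  {morph gword_inv : u v / (u ++ v : gword X) >-> (v ++ u : gword X)}.
Proof. by move=> u v; rewrite /gword_inv map_cat rev_cat. Qed.

HB.instance Definition _ := isStarMonoid.Build (gword X)
  (@catA (bool * X)) (@cat0s (bool * X)) gword_invK gword_invM.

Definition letter (x : X) : gword X := [:: (false, x)].

(* The least monoid congruence that contains R and identifies w^-1 * w with 1. *)
Inductive gcong (R : gword X -> gword X -> Prop) :
    gword X -> gword X -> Prop :=
  | gcong_rel u v : R u v -> gcong R u v
  | gcong_mulV w : gcong R (w^-1 * w) 1
  | gcong_mul u u' v v' :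
      gcong R u u' -> gcong R v v' -> gcong R (u * v) (u' * v')
  | gcong_refl u : gcong R u u
  | gcong_sym u v : gcong R u v -> gcong R v u
  | gcong_trans u v w : gcong R u v -> gcong R v w -> gcong R u w.

Variable R : gword X -> gword X -> Prop.

Definition gcongb : rel (gword X) := fun u v => `[< gcong R u v >].

Fact gcongb_refl : reflexive gcongb.
Proof. by move=> u; apply/asboolP; apply: gcong_refl. Qed.

Fact gcongb_sym : symmetric gcongb.
Proof. by move=> u v; apply: asbool_equiv_eq; split; apply: gcong_sym. Qed.

Fact gcongb_trans : transitive gcongb.
Proof.
by move=> v u w /asboolP uv /asboolP vw; apply/asboolP; apply: gcong_trans vw.
Qed.

Canonical gcongb_equiv := EquivRel gcongb gcongb_refl gcongb_sym gcongb_trans.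

(* The group < X | u = v for all u, v such that R u v >. *)
Definition presented : Type := {eq_quot gcongb}.

HB.instance Definition _ := Choice.on presented.
HB.instance Definition _ := EqQuotient.on presented.

Fact pi_gcong u v : \pi_presented u = \pi_presented v <-> gcong R u v.
Proof. by split=> [/eqmodP/asboolP | uv] //; apply/eqmodP/asboolP. Qed.

Definition pres_one : presented := \pi_presented (1 : gword X).
Definition pres_mul (a b : presented) : presented := \pi_presented (repr a * repr b).
Definition pres_inv (a : presented) : presented := \pi_presented ((repr a)^-1).

Fact gcong_repr u : gcong R (repr (\pi_presented u)) u.
Proof. by apply/pi_gcong; rewrite reprK. Qed.

Fact pi_pres_mul u v :
  pres_mul (\pi_presented u) (\pi_presented v) = \pi_presented (u * v).
Proof. by apply/pi_gcong/gcong_mul; apply: gcong_repr. Qed.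

Fact pres_mulA : associative pres_mul.
Proof.
elim/quotW=> u; elim/quotW=> v; elim/quotW=> w.
by rewrite (pi_pres_mul v) (pi_pres_mul u v) !pi_pres_mul mulgA.
Qed.

Fact pres_mul1 : left_id pres_one pres_mul.
Proof. by elim/quotW=> u; rewrite /pres_one pi_pres_mul mul1g. Qed.

Fact pres_mulr1 : right_id pres_one pres_mul.
Proof. by elim/quotW=> u; rewrite /pres_one pi_pres_mul mulg1. Qed.

Fact pres_mulV : left_inverse pres_one pres_inv pres_mul.
Proof.
move=> a; rewrite -{2}(reprK a) pi_pres_mul.
exact/pi_gcong/gcong_mulV.
Qed.

Fact pres_mulrV : right_inverse pres_one pres_inv pres_mul.
Proof.
move=> a; rewrite -{1}(reprK a) pi_pres_mul -{1}[repr a]invgK.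
exact/pi_gcong/gcong_mulV.
Qed.

HB.instance Definition _ := isGroup.Build presented
  pres_mulA pres_mul1 pres_mulr1 pres_mulV pres_mulrV.

End GroupWords.

Section TensorSquare.
Variable G : groupType.

Inductive tensor_rel (W : starMonoidType) (t : G -> G -> W) : W -> W -> Prop :=
  | tensor_mulr g h h1 :
      tensor_rel t (t g (h * h1)) (t g h1 * t (g ^ h1) (h ^ h1))
  | tensor_mull g g1 h :
      tensor_rel t (t (g * g1) h) (t (g ^ g1) (h ^ g1) * t g1 h).

Definition tens0 (g h : G) : gword (G * G)%type := letter (g, h).

Definition tensor_square : groupType := presented (tensor_rel tens0).

Definition tens (g h : G) : gword (G * G + G)%type := letter (inl (g, h)).
Definition hat (k : G) : gword (G * G + G)%type := letter (inr k).

(* When i < q the truncated subtraction q.-1 - i is exact. *)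
Inductive qtensor_rel (q : nat) :
    gword (G * G + G)%type -> gword (G * G + G)%type -> Prop :=
  | qtensor_tens u v : tensor_rel tens u v -> qtensor_rel q u v
  | qtensor_conj g h k :
      qtensor_rel q (tens g h ^ hat k) (tens (g ^ (k ^+ q)) (h ^ (k ^+ q)))
  | qtensor_hatM k k1 :
      qtensor_rel q (hat (k * k1))
        (hat k * (\prod_(1 <= i < q) tens k ((k1 ^- i) ^ (k ^+ (q.-1 - i))))
           * hat k1)
  | qtensor_hatR k k1 :
      qtensor_rel q [~ hat k, hat k1] (tens (k ^+ q) (k1 ^+ q))
  | qtensor_Rhat g h :
      qtensor_rel q (hat [~ g, h]) (tens g h ^+ q).

(* For q = 0 there are no generators of the form hat k. *)
Definition qtensor_square (q : nat) : groupType :=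
  if q is 0 then tensor_square else presented (qtensor_rel q).

End TensorSquare.

(* The exponent of a possibly infinite group; it is 0 if no positive power    *)
(* annihilates the group.                                                     *)
Definition gexponent (G : groupType) : nat :=
  if pselect (exists e, (0 < e) && `[< forall x : G, x ^+ e = 1 >]) is left ex_e
  then ex_minn ex_e else 0.

Lemma gexponent_fin (gT : finGroupType) : gexponent gT = exponent [set: gT].
Proof.
have expT : forall x : gT, x ^+ exponent [set: gT] = 1.
  by move=> x; apply: expg_exponent; rewrite inE.
rewrite /gexponent; case: pselect => [ex_e|[]]; last first.
  by exists (exponent [set: gT]); rewrite exponent_gt0; apply/asboolP.
case: ex_minnP => e /andP[e_gt0 /asboolP exp_e] min_e.
apply/eqP; rewrite eqn_leq min_e ?exponent_gt0; last exact/asboolP.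
by rewrite dvdn_leq //; apply/exponentP => x _; apply: exp_e.
Qed.

(* Main.v *)
(* Let e "act as" x in G when t(g,h)^e = t(g^x,h^x). Then t(x,y) acts as
   [x,y] and hat k as k^q, and for a product w of tensors acting as c one has
   [w, e] = t(c,x). For G of class 3 and exponent n, comparing the collection
   formula for (gx)^n with its variants gives c^C(n,2) = 1 for c in G' and
   [x,g,x]^C(n,3) = 1. As t(_,x) is multiplicative on G', expanding t(g^n,h)
   yields t(g,h)^n = 1, and then every product of tensors has trivial n-th
   power. Every element of the q-tensor square is hat k * w; here t(c,k^q)
   commutes with w and, by relation (6), with hat k, since
   t(z,k)^q = hat [z,k] = 1 for central z. Hence
   (hat k * w)^n = (hat k)^n = t(k,k)^(C(q,2) C(n,2)). *)

Require Import Defs.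
From mathcomp Require Import all_boot all_fingroup all_solvable.
From mathcomp Require Import boolp zify.

Set Implicit Arguments.
Unset Strict Implicit.
Unset Printing Implicit Defensive.

Import GroupScope.
Local Open Scope group_scope.

(** * Power and commutator formulas in a finite group with ['L_4 = 1] *)

Section ClassThree.

Variable gT : finGroupType.
Hypothesis L4 : 'L_4([set: gT]) = 1.

Lemma mem_comm_der1 (x y : gT) : [~ x, y] \in [set: gT]^`(1).
Proof. by rewrite mem_commg ?inE. Qed.

Lemma comm_der1_central c (x y : gT) :
  c \in [set: gT]^`(1) -> commute [~ c, x] y.
Proof.
move=> cD; apply/commgP; rewrite -in_set1.
have : [~ c, x, y] \in 'L_4([set: gT]) by rewrite !lcnSn !mem_commg ?inE.
by rewrite L4.
Qed.

(** The three subgroup lemma turns [[G', G, G] = 1] into [[G, G, G'] = 1]. *)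
Lemma der1_commute c d :
  c \in [set: gT]^`(1) -> d \in [set: gT]^`(1) -> commute c d.
Proof.
have cTTD : [~: [set: gT], [set: gT], [set: gT]^`(1)] = 1.
  have DTT : [~: [set: gT]^`(1), [set: gT], [set: gT]] = 1 by [].
  by apply: three_subgroup; rewrite // [X in [~: X, _]]commGC.
move=> cD dD; apply/commgP; rewrite -in_set1.
have : [~ c, d] \in [~: [set: gT]^`(1), [set: gT]^`(1)] by rewrite mem_commg.
by rewrite {1}derg1 cTTD.
Qed.

Lemma comm_expgr_class3 (x g : gT) m :
  [~ x, g ^+ m] = [~ x, g] ^+ m * [~ x, g, g] ^+ 'C(m, 2).
Proof.
set c := [~ x, g]; set z := [~ c, g].
have cD : c \in [set: gT]^`(1) by apply: mem_comm_der1.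
have zC y : commute z y by apply: comm_der1_central.
elim: m => [|m IHm]; first by rewrite commg1 mulg1.
rewrite expgSr commgMJ -/c IHm conjMg !conjXg (conjg_mulR c) -/z.
have -> : z ^ g = z by rewrite conjgE zC mulKg.
rewrite expgMn; last by apply/commute_sym/zC.
by rewrite binS bin1 addnC expgnDr !mulgA expgS.
Qed.

(** Collection by induction on [m]. The exponent of [[~ x, g, x]] is the sum of the squares [i * i]
    for [i < m], and ['C(m, 3)] is the sum of the ['C(i, 2)]. *)
Lemma expgM_class3 (g x : gT) m :
  (g * x) ^+ m = g ^+ m * x ^+ m * [~ x, g] ^+ 'C(m, 2)
    * [~ x, g, x] ^+ ('C(m, 2) + 2 * 'C(m, 3)) * [~ x, g, g] ^+ 'C(m, 3).
Proof.
have := comm_expgr_class3 x g; set c := [~ x, g].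
set y := [~ c, x]; set z := [~ c, g] => cgX.
have cD : c \in [set: gT]^`(1) by apply: mem_comm_der1.
have yC u : commute y u by apply: comm_der1_central.
have zC u : commute z u by apply: comm_der1_central.
have yXC i u : y ^+ i * u = u * y ^+ i by apply/commute_sym/commuteX/commute_sym.
have zXC i u : z ^+ i * u = u * z ^+ i by apply/commute_sym/commuteX/commute_sym.
have cxX i j : c ^+ i * x ^+ j = x ^+ j * c ^+ i * y ^+ (i * j).
  by rewrite [LHS]commgC commXXg //; apply: commute_sym.
elim: m => [|m IHm]; first by rewrite !mulg1.
have -> : 'C(m.+1, 3) = 'C(m, 2) + 'C(m, 3) by rewrite binS addnC.
have -> : 'C(m.+1, 2) = m + 'C(m, 2) by rewrite binS bin1 addnC.
(* The new term [m * m] arises when [c ^+ m] crosses [x ^+ m]. *)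
have -> : m + 'C(m, 2) + 2 * ('C(m, 2) + 'C(m, 3))
          = m * m + ('C(m, 2) + 2 * 'C(m, 3)).
  by have := mul_bin_diag m 1; rewrite bin1; nia.
have xgX : x * g ^+ m = g ^+ m * (x * c ^+ m * z ^+ 'C(m, 2)).
  by rewrite -mulgA -cgX mulgA -commgC.
rewrite expgS IHm !expgS !expgnDr -!mulgA (mulgA x) xgX -!mulgA.
congr (g * (g ^+ m * (x * _))).
rewrite zXC -!mulgA (mulgA (c ^+ m)) cxX -!mulgA; congr (x ^+ m * (c ^+ m * _)).
by rewrite yXC -mulgA -yXC (zXC 'C(m, 3)).
Qed.

Variable n : nat.
Hypothesis expG : forall x : gT, x ^+ n = 1.

Lemma expg_comm_class3 (g x : gT) :
  [~ x, g] ^+ 'C(n, 2) = 1 /\ [~ x, g, x] ^+ 'C(n, 3) = [~ x, g, g] ^+ 'C(n, 3).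
Proof.
have E (u v : gT) : [~ u, v] ^+ 'C(n, 2)
    * [~ u, v, u] ^+ ('C(n, 2) + 2 * 'C(n, 3)) * [~ u, v, v] ^+ 'C(n, 3) = 1.
  by have := expgM_class3 v u n; rewrite !expG !mul1g => <-.
have zC (u v w r : gT) : commute [~ u, v, w] r.
  exact/comm_der1_central/mem_comm_der1.
(* By [E], [[~ u, v] ^+ 'C(n, 2)] is a product of central elements, so its commutator with [w] is
   trivial. *)
have z2 (u v w : gT) : [~ u, v, w] ^+ 'C(n, 2) = 1.
  rewrite -commXg; last by apply/commute_sym/zC.
  have -> : [~ u, v] ^+ 'C(n, 2) = ([~ u, v, u] ^+ ('C(n, 2) + 2 * 'C(n, 3))
      * [~ u, v, v] ^+ 'C(n, 3))^-1.
    by apply/eqP; rewrite -mulg_eq1 mulgA E.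
  apply/eqP/commgP/commute_sym/commuteV/commuteM; apply/commuteX/commute_sym/zC.
have {}E (u v : gT) : [~ u, v] ^+ 'C(n, 2)
    * ([~ u, v, u] ^+ (2 * 'C(n, 3)) * [~ u, v, v] ^+ 'C(n, 3)) = 1.
  by have := E u v; rewrite expgnDr z2 mul1g -mulgA.
(* Exchanging [g] and [x] inverts the commutator. With [A], [B], [Z] as set below, [A * B^2 * Z = 1]
   and [A^-1 * Z^-2 * B^-1 = 1], hence [B = Z]. *)
have eqBZ : [~ x, g, x] ^+ 'C(n, 3) = [~ x, g, g] ^+ 'C(n, 3).
  have := E g x; rewrite -!(invgR x g).
  rewrite !(commVg (commute_sym (zC _ _ _ _))) !expVgn.
  have := E x g; set A := _ ^+ 'C(n, 2); rewrite !(mulnC 2) !expgM.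
  set B := _ ^+ 'C(n, 3); set Z := _ ^+ 'C(n, 3) => ABZ.
  have BZ : commute B Z by apply/commuteX/commute_sym/commuteX/zC.
  move/mulg1_eq; rewrite invgK => A_def; move: ABZ; rewrite A_def !expg2.
  by rewrite invMg -!mulgA mulKg BZ mulKg => /mulg1_eq; rewrite invgK.
split=> //.
have := E x g; rewrite -eqBZ -expgnDr.
(* The exponent left on [[~ x, g, x]] is a multiple of ['C(n, 2)], so [z2] kills this factor. *)
have -> : (2 * 'C(n, 3) + 'C(n, 3) = 'C(n, 2) * (n - 2))%N.
  by have := mul_bin_left n 2; nia.
by rewrite expgM z2 expg1n mulg1.
Qed.

Lemma expg_der1_class3 c : c \in [set: gT]^`(1) -> c ^+ 'C(n, 2) = 1.
Proof.
case/gen_prodgP=> m [F F_comm ->].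
elim: m F F_comm => [|m IHm] F F_comm; first by rewrite big_ord0 expg1n.
have FD i : F i \in [set: gT]^`(1) by apply: mem_gen.
rewrite big_ord_recl expgMn.
  rewrite IHm // mulg1; have /imset2P[x g _ _ ->] := F_comm ord0.
  by case: (expg_comm_class3 g x).
by apply: der1_commute; rewrite ?group_prod.
Qed.

(** Put [x * g] for [x] in the equality of ['C(n, 3)]-th powers: with [c = [~ x, g]] and
    [[~ x * g, g] = c * [~ c, g]], it becomes [([~ c, g] * [~ c, x]) ^+ 'C(n, 3) = [~ c, g] ^+ 'C(n,
    3)]. *)
Lemma expg_comm3_class3 (x g : gT) : [~ x, g, x] ^+ 'C(n, 3) = 1.
Proof.
have [_ eqBZ] := expg_comm_class3 g x.
have [_] := expg_comm_class3 g (x * g).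
set c := [~ x, g] in eqBZ *; have cD : c \in [set: gT]^`(1) by apply: mem_comm_der1.
have zC y r : commute [~ c, y] r by apply: comm_der1_central.
have -> : [~ x * g, g] = c * [~ c, g] by rewrite commMgJ commgg mulg1 conjg_mulR.
have czE y : [~ c * [~ c, g], y] = [~ c, y].
  have /commgP/eqP z1 := zC g y.
  by rewrite commMgJ z1 mulg1 /conjg zC mulKg.
rewrite !czE commgMJ /conjg (zC x) mulKg expgMn; last exact: zC.
by rewrite -[RHS]mulg1 => /mulgI.
Qed.

End ClassThree.

(* expMg_Rmul without the finiteness assumption. *)
Lemma expgMR (W : groupType) (x y : W) m :
  commute x [~ x, y] -> commute y [~ x, y] ->
  (y * x) ^+ m = y ^+ m * x ^+ m * [~ x, y] ^+ 'C(m, 2).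
Proof.
set z := [~ x, y] => xz yz.
have xyX i : x * y ^+ i = y ^+ i * x * z ^+ i.
  elim: i => [|i IHi]; first by rewrite mul1g !mulg1.
  rewrite expgSr mulgA IHi -[LHS]mulgA -(commuteX _ yz) [LHS]mulgA.
  rewrite -[X in X * _]mulgA [x * y]commgC -/z expgS.
  by rewrite !mulgA.
elim: m => [|m IHm]; first by rewrite !mulg1.
rewrite expgS IHm binS bin1 addnC expgnDr !expgS !mulgA; congr (_ * _).
rewrite -!mulgA; congr (y * _); rewrite !mulgA xyX -!mulgA.
by congr (_ * (_ * _)); apply/commute_sym/commuteX2.
Qed.

(** * Calculus of tensors in a group satisfying relations (1) and (2) *)

Section Tensors.

Variables (gT : finGroupType) (W : groupType) (t : gT -> gT -> W).
Hypothesis tens_rel : forall u v, tensor_rel t u v -> u = v.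

Let tensMr g h h1 : t g (h * h1) = t g h1 * t (g ^ h1) (h ^ h1).
Proof. exact/tens_rel/tensor_mulr. Qed.

Let tensMl g g1 h : t (g * g1) h = t (g ^ g1) (h ^ g1) * t g1 h.
Proof. exact/tens_rel/tensor_mull. Qed.

Lemma tens1g h : t 1 h = 1.
Proof.
apply: (mulgI (t 1 h)); have := tensMl 1 1 h.
by rewrite mulg1 !conjg1 => <-; rewrite mulg1.
Qed.

Lemma tensg1 g : t g 1 = 1.
Proof.
apply: (mulgI (t g 1)); have := tensMr g 1 1.
by rewrite mulg1 !conjg1 => <-; rewrite mulg1.
Qed.

Lemma tensV g h : (t g h)^-1 = t (g ^ h) h^-1.
Proof.
have hh : h^-1 ^ h = h^-1 by rewrite conjgE mulVg mulg1.
apply: mulg1_eq; have := tensMr g h^-1 h.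
by rewrite mulVg tensg1 hh => <-.
Qed.

Lemma tens_conj g h x y : t g h ^ t x y = t (g ^ [~ x, y]) (h ^ [~ x, y]).
Proof.
(* Both sides come from the two expansions of [t (a * x) (b * y)]. *)
suffices E a b : t (a ^ (y * x)) (b ^ (y * x)) * t x y
             = t x y * t (a ^ (x * y)) (b ^ (x * y)).
  have := E (g ^ (y * x)^-1) (h ^ (y * x)^-1).
  rewrite -!(conjgM _ (y * x)^-1) mulVg !conjg1 => {}E.
  have -> : [~ x, y] = (y * x)^-1 * (x * y).
    by rewrite /commg /conjg invMg !mulgA.
  by rewrite conjgE E mulKg.
have := tensMl a x (b * y).
rewrite conjMg (tensMr (a ^ x)) (tensMr x) (tensMr (a * x)) (tensMl a x y) conjMg.
rewrite (tensMl (a ^ y)) -!conjgM -!conjgC -!mulgA => /mulgI.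
by rewrite !mulgA => /mulIg ->.
Qed.

Definition acts_as (e : W) (x : gT) :=
  forall g h, t g h ^ e = t (g ^ x) (h ^ x).

(* [tens_prod w c]: w is a product of tensors whose image in [G, G] is c. *)
Inductive tens_prod : W -> gT -> Prop :=
  | tens_prod1 : tens_prod 1 1
  | tens_prod_tens g h : tens_prod (t g h) [~ g, h]
  | tens_prodM w c w' c' :
      tens_prod w c -> tens_prod w' c' -> tens_prod (w * w') (c * c').

Lemma tens_prodV w c : tens_prod w c -> tens_prod w^-1 c^-1.
Proof.
elim=> [|g h|v a v' a' _ IHv _ IHv']; first by rewrite !invg1; apply: tens_prod1.
  rewrite tensV (_ : [~ g, h]^-1 = [~ g ^ h, h^-1]); first exact: tens_prod_tens.
  by rewrite /commg conjgK invMg invgK.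
by rewrite !invMg; apply: tens_prodM.
Qed.

Lemma tens_prod_conj e x w c :
  acts_as e x -> tens_prod w c -> tens_prod (w ^ e) (c ^ x).
Proof.
move=> ex; elim=> [|g h|v a v' a' _ IHv _ IHv'].
- by rewrite !conj1g; apply: tens_prod1.
- by rewrite ex conjRg; apply: tens_prod_tens.
by rewrite !conjMg; apply: tens_prodM.
Qed.

Lemma tens_prod_acts w c : tens_prod w c -> acts_as w c.
Proof.
elim=> [g h|g h x y|v a v' a' _ IHv _ IHv' g h]; first by rewrite !conjg1.
  exact: tens_conj.
by rewrite conjgM IHv IHv' -!conjgM.
Qed.

Lemma tens_prod_der1 w c : tens_prod w c -> c \in [set: gT]^`(1).
Proof.
elim=> [|g h|v a v' a' _ vD _ v'D]; first exact: group1.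
  exact: mem_comm_der1.
exact: groupM.
Qed.

(** Expand [t g (h * x)] by relation (1) in two ways, using [h * x = x ^ h^-1 * h]; then expand
    [t (g ^ h) x] by relation (2) through [g ^ h = g * [~ g, h]]. *)
Lemma tens_comm g h x : t (g ^ x) (h ^ x) = t g h * t [~ g, h] x.
Proof.
have E1 := tensMr g h x; have E2 := tensMr g (x ^ h^-1) h.
rewrite conjgKV -conjgCV {}E1 in E2.
have := tensMl g [~ g, h] x; rewrite -conjg_mulR -tens_conj => E3.
apply: (mulgI (t g x)); rewrite E2 E3 conjgE !mulgA; congr (_ * _).
by rewrite mulgV mul1g.
Qed.

(** [tens_comm] is the case of one tensor. Relation (2) assembles products, because [v'] acts on
    tensors as [a']. *)
Lemma tens_prod_comm e x w c :
  acts_as e x -> tens_prod w c -> w ^ e = w * t c x.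
Proof.
move=> ex; elim=> [|g h|v a v' a' _ IHv v'a' IHv'].
- by rewrite conj1g tens1g mulg1.
- by rewrite ex tens_comm.
rewrite conjMg IHv IHv' tensMl -(tens_prod_acts v'a') -!mulgA; congr (_ * _).
by rewrite mulVKg.
Qed.

Hypothesis L4 : 'L_4([set: gT]) = 1.

Lemma acts_central_commute e z w c :
  acts_as e z -> (forall y, commute z y) -> tens_prod w c -> commute w e.
Proof.
move=> ez zC wc; have zx x : x ^ z = x by rewrite conjgE -zC mulKg.
have tz g h : t g h ^ e = t g h by rewrite ez !zx.
apply/commgP; rewrite -conjg_fix; apply/eqP; elim: wc => [|g h|v a v' a' _ IHv _ IHv'] //.
  exact: conj1g.
by rewrite conjMg IHv IHv'.
Qed.

Lemma tens_der1_commute c x w d :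
  c \in [set: gT]^`(1) -> tens_prod w d -> commute w (t c x).
Proof.
move=> cD; apply: acts_central_commute (tens_prod_acts (tens_prod_tens c x)) _.
by move=> y; apply: comm_der1_central.
Qed.

(** Relation (2) conjugates by [c]; this action is realised by [w], which commutes with [t c x] in
    class 3. *)
Lemma tens_der1X w c x m : tens_prod w c -> t (c ^+ m) x = t c x ^+ m.
Proof.
move=> wc; have cD := tens_prod_der1 wc.
elim: m => [|m IHm]; first exact: tens1g.
rewrite expgSr tensMl -(tens_prod_acts wc) IHm expgSr; congr (_ * _).
by apply/conjg_fixP/commgP/commute_sym/commuteX; apply: tens_der1_commute wc.
Qed.

Lemma tens_centralX z g m :
  (forall y, commute z y) -> t z (g ^+ m) = t z g ^+ m.
Proof.
move=> zC; have zx x : z ^ x = z by rewrite conjgE zC mulKg.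
elim: m => [|m IHm]; first exact: tensg1.
have gg : g ^ (g ^+ m) = g by rewrite conjgE commuteX // mulKg.
by rewrite expgS tensMr IHm zx gg expgSr.
Qed.

(** By relation (2) and [tens_comm], passing from [m] to [m.+1] contributes [t g h * t [~ g, h] (g
    ^+ m)]; the three kinds of factors commute pairwise. *)
Lemma tens_powl g h m :
  t (g ^+ m) h = t g h ^+ m * t [~ g, h] g ^+ 'C(m, 2)
                   * t [~ g, h, g] g ^+ 'C(m, 3).
Proof.
set c := [~ g, h]; have cD : c \in [set: gT]^`(1) by apply: mem_comm_der1.
have zD : [~ c, g] \in [set: gT]^`(1) by apply: mem_comm_der1.
have zC y : commute [~ c, g] y by apply: comm_der1_central.
have Tu := tens_der1_commute g cD (tens_prod_tens g h).
have Tv := tens_der1_commute g zD (tens_prod_tens g h).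
have uv := tens_der1_commute g zD (tens_prod_tens c g).
set T := t g h in Tu Tv *; set u := t c g in Tu uv *.
set v := t _ g in Tv uv *.
(* Each further factor [g] contributes [u * v ^+ j], because [[~ c, g]] is central. *)
have tcX j : t c (g ^+ j) = u ^+ j * v ^+ 'C(j, 2).
  elim: j => [|j IHj]; first by rewrite tensg1 mulg1.
  rewrite expgS tensMr IHj tens_comm -/u tens_centralX // -/v.
  rewrite binS bin1 expgnDr expgSr -!mulgA; congr (_ * _).
  by rewrite !mulgA; congr (_ * _); apply/commute_sym/commuteX.
elim: m => [|m IHm]; first by rewrite tens1g !mulg1.
rewrite expgS tensMl tens_comm -/T -/c tcX IHm.
rewrite !binS bin1 expgS (addnC 'C(m, 2)) (addnC 'C(m, 3)) !expgnDr.
rewrite -!mulgA; congr (T * _); rewrite (mulgA (v ^+ _)) -(commuteX2 _ _ Tv).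
rewrite -!mulgA (mulgA (u ^+ _)) -(commuteX2 _ _ Tu) -!mulgA.
by congr (_ * (_ * _)); rewrite !mulgA (commuteX2 _ _ uv).
Qed.

Variable n : nat.
Hypothesis expG : forall x : gT, x ^+ n = 1.

Lemma tens_expg g h : t g h ^+ n = 1.
Proof.
have wc := tens_prod_tens g h; have wz := tens_prod_tens [~ g, h] g.
have := tens_powl g h n; rewrite expG tens1g -(tens_der1X _ _ wc) -(tens_der1X _ _ wz).
rewrite expg_der1_class3 ?mem_comm_der1 // expg_comm3_class3 // !tens1g.
by rewrite !mulg1.
Qed.

Lemma tens_der1_expg c x w : tens_prod w c -> t c x ^+ 'C(n, 2) = 1.
Proof.
move=> wc; rewrite -(tens_der1X _ _ wc) expg_der1_class3 ?tens1g //.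
exact: tens_prod_der1 wc.
Qed.

Lemma tens_prod_expg w c : tens_prod w c -> w ^+ n = 1.
Proof.
elim=> [|g h|v a v' a' va v1 va' v'1]; first exact: expg1n.
  exact: tens_expg.
(* The correction in [(v * v') ^+ n] is the ['C(n, 2)]-th power of this commutator, which
   [tens_der1_expg] kills. *)
have uE : [~ v', v] = t a' a.
  by rewrite commgEl (tens_prod_comm (tens_prod_acts va) va') mulKg.
have uC b d : tens_prod b d -> commute b (t a' a).
  by apply: tens_der1_commute; apply: tens_prod_der1 va'.
by rewrite expgMR uE ?v1 ?v'1 ?(tens_der1_expg _ va') ?mulg1 //; apply: uC; eassumption.
Qed.

End Tensors.

(** * The elements [hat k] and the normal form [hat k * w] *)

Section QTensors.

Variables (gT : finGroupType) (W : groupType) (t : gT -> gT -> W) (hat : gT -> W).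
Variable q : nat.
Hypothesis tens_rel : forall u v, tensor_rel t u v -> u = v.
Hypothesis hat_acts : forall k, acts_as t (hat k) (k ^+ q).
Hypothesis hatM : forall k k1, hat (k * k1) =
  hat k * (\prod_(1 <= i < q) t k ((k1 ^- i) ^ (k ^+ (q.-1 - i)))) * hat k1.
Hypothesis hatR : forall g h, hat [~ g, h] = t g h ^+ q.

Lemma hat1 : hat 1 = 1.
Proof. by have := hatR 1 1; rewrite commgg (tens1g tens_rel) expg1n. Qed.

Lemma tens_powr k m : t k (k ^+ m) = t k k ^+ m.
Proof.
elim: m => [|m IHm]; first exact: (tensg1 tens_rel).
have kk i : k ^ (k ^+ i) = k by rewrite conjgE commuteX // mulKg.
by rewrite expgS (tens_rel (tensor_mulr _ _ _ _)) !kk IHm expgSr.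
Qed.

(** In relation (4) for [k] and [k ^+ m], the [i]-th tensor is the inverse of [t k k ^+ (i * m)],
    and the [i < q] sum to ['C(q, 2)]. *)
Lemma hat_pow k m : hat k ^+ m = hat (k ^+ m) * t k k ^+ ('C(q, 2) * 'C(m, 2)).
Proof.
have kk i : k ^ (k ^+ i) = k by rewrite conjgE commuteX // mulKg.
have Tk j : commute (hat (k ^+ j)) (t k k).
  by apply/commute_sym/commgP; rewrite -conjg_fix hat_acts -expgnA !kk.
elim: m => [|m IHm]; first by rewrite bin0n muln0 !expg0 hat1 mulg1.
have prodE : \prod_(1 <= i < q) t k (((k ^+ m) ^- i) ^ (k ^+ (q.-1 - i)))
    = (t k k ^+ ('C(q, 2) * m))^-1.
  have -> : ('C(q, 2) * m = \sum_(1 <= i < q) i * m)%N.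
    rewrite -bin2_sum -big_distrl; congr (_ * m)%N.
    (* [bin2_sum] starts at [0], so its zero term is dropped; for [q = 0] both ranges are empty. *)
    by case: q => [|r]; [rewrite !big_geq | rewrite big_ltn].
  rewrite -expVgn -prodgXr.
  apply: eq_bigr => i _; rewrite conjVg !conjXg kk.
  by rewrite expVgn -expgnA mulnC -tens_powr (tensV tens_rel) kk.
rewrite expgS IHm expgS hatM prodE binS bin1 addnC mulnDr expgnDr.
rewrite mulgA -!mulgA; congr (hat k * _).
have /commuteV/commute_sym TVk := commuteX ('C(q, 2) * m) (Tk m).
by rewrite mulgA TVk -!mulgA mulKg.
Qed.

Definition hat_tens (e : W) := exists k w c, e = hat k * w /\ tens_prod t w c.

Lemma hat_tens_tens w c : tens_prod t w c -> hat_tens w.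
Proof. by move=> wc; exists 1, w, c; rewrite hat1 mul1g. Qed.

(** Relation (4) solved for [hat k * hat k1]: the inverse of its product of tensors moves right
    across [hat k1]. *)
Lemma hat_prod_tens k k1 : exists w c, 
  hat k * hat k1 = hat (k * k1) * w /\ tens_prod t w c.
Proof.
have [c Pc] : exists c, tens_prod t 
    (\prod_(1 <= i < q) t k ((k1 ^- i) ^ (k ^+ (q.-1 - i)))) c.
  elim/big_rec: _ => [|i x _ [c xc]]; first by exists 1; apply: tens_prod1.
  by eexists; apply: tens_prodM xc; apply: tens_prod_tens.
have := hatM k k1; set p := \prod_(1 <= i < q) _ in Pc * => ->.
exists (p^-1 ^ hat k1); eexists; split; last first.
  exact: tens_prod_conj (tens_prodV tens_rel Pc).
by rewrite -!mulgA mulVKg mulKVg.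
Qed.

Lemma hat_tensM e e' : hat_tens e -> hat_tens e' -> hat_tens (e * e').
Proof.
move=> [k [w [c [-> wc]]]] [k' [w' [c' [-> w'c']]]].
have [p [d [E pd]]] := hat_prod_tens k k'.
exists (k * k'), (p * (w ^ hat k' * w')); eexists; split.
  by rewrite (mulgA (hat _)) -E conjgE -!mulgA mulVKg.
exact: tens_prodM pd (tens_prodM (tens_prod_conj (hat_acts k') wc) w'c').
Qed.

Lemma hat_tensV k : hat_tens (hat k)^-1.
Proof.
have [p [d [E pd]]] := hat_prod_tens k k^-1.
exists k^-1, p^-1; eexists; split; last exact: (tens_prodV tens_rel pd).
by apply: mulg1_eq; rewrite mulgA E mulgV hat1 mul1g mulgV.
Qed.

Hypothesis L4 : 'L_4([set: gT]) = 1.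
Variable n : nat.
Hypothesis expG : forall x : gT, x ^+ n = 1.

Lemma hat_tens_expg e : 
  hat_tens e -> exists k, e ^+ n = t k k ^+ ('C(q, 2) * 'C(n, 2)).
Proof.
move=> [k [w [c [-> wc]]]]; exists k.
have uE : [~ w, hat k] = t c (k ^+ q).
  by rewrite commgEl (tens_prod_comm tens_rel (hat_acts k) wc) mulKg.
have cD := tens_prod_der1 wc.
have zC y : commute [~ c, k ^+ q] y by apply: comm_der1_central.
rewrite expgMR uE.
- rewrite hat_pow expG hat1 mul1g (tens_prod_expg tens_rel L4 expG wc).
  by rewrite (tens_der1_expg tens_rel L4 expG _ wc) !mulg1.
- exact: (tens_der1_commute tens_rel L4 _ cD wc).
(* Conjugation by [hat k] multiplies [t c (k ^+ q)] by [t z (k ^+ q)], where [z = [~ c, k ^+ q]] is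
   central; this factor is [t z k ^+ q = hat [~ z, k] = hat 1]. *)
apply/commute_sym/commgP; rewrite -conjg_fix hat_acts (tens_comm tens_rel).
rewrite (tens_centralX tens_rel k q zC) -hatR.
have /commgP/eqP -> := zC k.
by rewrite hat1 mulg1.
Qed.

End QTensors.

(** * Morphism from words to a presented group, and induction on its elements *)

Section Presented.

Variables (X : choiceType) (R : gword X -> gword X -> Prop).

Definition pres_class (u : gword X) : presented R := \pi_(presented R)%qT u.

Lemma pres_classM u v : pres_class (u * v) = pres_class u * pres_class v.
Proof. exact/esym/pi_pres_mul. Qed.

Lemma pres_class1 : pres_class 1 = 1.
Proof. by []. Qed.

Lemma pres_classV u : pres_class u^-1 = (pres_class u)^-1.
Proof.
apply/esym/mulg1_eq; rewrite -pres_classM -[u in u * _]invgK.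
exact/pi_gcong/gcong_mulV.
Qed.

Lemma pres_classJ u v : pres_class (u ^ v) = pres_class u ^ pres_class v.
Proof. by rewrite !pres_classM pres_classV. Qed.

Lemma pres_classX u m : pres_class (u ^+ m) = pres_class u ^+ m.
Proof. by elim: m => // m IHm; rewrite !expgS pres_classM IHm. Qed.

Lemma pres_class_rel u v : R u v -> pres_class u = pres_class v.
Proof. by move=> Ruv; apply/pi_gcong/gcong_rel. Qed.

Lemma presented_ind (P : presented R -> Prop) :
  P 1 -> (forall e e', P e -> P e' -> P (e * e')) ->
  (forall x, P (pres_class (letter x)) /\ P (pres_class (letter x))^-1) ->
  forall e, P e.
Proof.
move=> P1 PM Px; elim/quotW=> u; change (P (pres_class u)).
elim: u => [|[b x] u IHu]; first exact: P1.
rewrite -cat1s -[_ ++ _]/(([:: (b, x)] : gword X) * u) pres_classM.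
apply: PM IHu; have [] := Px x; case: b => //.
by rewrite -pres_classV.
Qed.

End Presented.

Lemma gexponent_dvd (G : groupType) m :
  0 < m -> (forall x : G, x ^+ m = 1) -> gexponent G %| m.
Proof.
move=> m_gt0 exp_m; rewrite /gexponent; case: pselect => [ex_e|[]]; last first.
  by exists m; rewrite m_gt0; apply/asboolP.
case: ex_minnP => e /andP[e_gt0 /asboolP exp_e] min_e.
apply: contraT => ndvd; suffices : e <= m %% e by rewrite leqNgt ltn_mod e_gt0.
apply: min_e; rewrite lt0n ndvd; apply/asboolP => x.
by have := exp_m x; rewrite {1}(divn_eq m e) expgnDr mulnC expgnA exp_e expg1n mul1g.
Qed.

(** * Exponents of the tensor squares and the final divisibilities *)

Section Main.

Variables (gT : finGroupType) (n : nat).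
Hypothesis L4 : 'L_4([set: gT]) = 1.
Hypothesis expG : forall x : gT, x ^+ n = 1.

Lemma tensor_square_expg (e : tensor_square gT) : e ^+ n = 1.
Proof.
pose t g h := pres_class (tensor_rel (@tens0 gT)) (tens0 g h).
have tens_rel u v : tensor_rel t u v -> u = v.
  by case=> [g h h1 | g g1 h]; rewrite /t -pres_classM; apply: pres_class_rel; constructor.
suffices [c ec] : exists c, tens_prod t e c by exact: tens_prod_expg ec.
elim/presented_ind: e => [|e e' [c ec] [c' ec'] | [g h]].
- by exists 1; apply: tens_prod1.
- by exists (c * c'); apply: tens_prodM.
have gh := tens_prod_tens t g h.
by split; eexists; [apply: gh | apply: (tens_prodV tens_rel gh)].
Qed.

(** For [q > 0] the witness is [t k k], with [k] taken from the normal form of [e]. For [q = 0]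
    there are no hats, so [e ^+ n = 1] and [w = 1] serves. *)
Lemma qtensor_square_expg q (e : qtensor_square gT q) :
  exists2 w : qtensor_square gT q, w ^+ n = 1 & e ^+ n = w ^+ ('C(q, 2) * 'C(n, 2)).
Proof.
case: q e => [|q] e; first by exists 1; rewrite ?tensor_square_expg ?expg1n.
pose cl := pres_class (qtensor_rel (G := gT) q.+1).
pose t g h := cl (tens g h); pose hatc k := cl (hat k).
have tens_rel u v : tensor_rel t u v -> u = v.
  case=> [g h h1 | g g1 h]; rewrite /t -pres_classM; apply: pres_class_rel;
    apply: qtensor_tens; constructor.
have hat_acts k : acts_as t (hatc k) (k ^+ q.+1).
  by move=> g h; rewrite -pres_classJ; apply: pres_class_rel (qtensor_conj _ g h k).
have hatM k k1 : hatc (k * k1) = hatc k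
    * (\prod_(1 <= i < q.+1) t k ((k1 ^- i) ^ (k ^+ (q - i)))) * hatc k1.
  rewrite /hatc [LHS](pres_class_rel (qtensor_hatM _ _ _)) !pres_classM.
  congr (_ * _ * _); apply: (big_morph _ (@pres_classM _ _)).
  exact: pres_class1.
have hatR g h : hatc [~ g, h] = t g h ^+ q.+1.
  by rewrite -pres_classX; apply: pres_class_rel (qtensor_Rhat _ g h).
suffices he : hat_tens t hatc e.
  have [k ->] := hat_tens_expg tens_rel hat_acts hatM hatR L4 expG he.
  by exists (t k k) => //; apply: tens_expg.
elim/presented_ind: e => [|e e' | [[g h]|k]].
- exact (hat_tens_tens tens_rel hatR (tens_prod1 t)).
- by move=> he he'; exact (hat_tensM tens_rel hat_acts hatM he he').
- have gh := tens_prod_tens t g h.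
  split; first exact (hat_tens_tens tens_rel hatR gh).
  exact (hat_tens_tens tens_rel hatR (tens_prodV tens_rel gh)).
split; last exact (hat_tensV tens_rel hat_acts hatM hatR k).
by exists k, 1, 1; rewrite mulg1; split=> //; apply: tens_prod1.
Qed.

End Main.

Theorem theorem5p2 (gT : finGroupType) (q : nat)
    (nilG : nilpotent [set: gT]) (classG : nil_class [set: gT] <= 3) :
  let n := exponent [set: gT] in
  (odd n \/ 4 %| q -> gexponent (qtensor_square gT q) %| n) /\
  (~ (odd n \/ 4 %| q) -> gexponent (qtensor_square gT q) %| 2 * n).
Proof.
move=> n; have n_gt0 : 0 < n by apply: exponent_gt0.
have expG (x : gT) : x ^+ n = 1 by apply: expg_exponent; rewrite inE.
(* The lower central series is indexed from 1, so class at most 3 means that its fourth term is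
   trivial. *)
have L4 : 'L_4([set: gT]) = 1 by apply/(lcn_nil_classP 3 nilG).
have expE := qtensor_square_expg L4 expG.
have C2n : (2 * 'C(n, 2) = n * n.-1)%N by rewrite -mul_bin_diag bin1.
split=> [nq|_]; apply: gexponent_dvd; rewrite ?muln_gt0 // => e.
  have [w w1 ->] := expE q e.
  suffices /dvdnP[d ->] : n %| 'C(q, 2) * 'C(n, 2).
    by rewrite mulnC expgnA w1 expg1n.
  case: nq => [n_odd | /dvdnP[r ->]].
    (* An odd [n] is coprime to 2 and divides [2 * 'C(n, 2)]. *)
    rewrite dvdn_mull // -(@Gauss_dvdr n 2) ?coprimen2 // C2n.
    exact: dvdn_mulr.
  (* For [q = r * 4] the factor ['C(q, 2)] is even and supplies the 2 needed in [C2n]. *)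
  have -> : 'C(r * 4, 2) = (2 * (r * (r * 4).-1))%N.
    by have := mul_bin_diag (r * 4) 1; rewrite bin1; nia.
  by rewrite mulnAC C2n -mulnA dvdn_mulr.
(* Here the 2 needed in [C2n] comes from the exponent [2 * n] itself. *)
have [w w1 e_n] := expE q e.
rewrite mulnC expgnA e_n -expgnA -mulnA (mulnC _ 2) C2n mulnCA expgnA w1.
exact: expg1n.
Qed.
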